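(* Let $0<\Phi<2\pi$ and $\hbar>0$. For every $n_\phi\in\{1,2,3,\ldots\}$, let $$u_{n_\phi}(\phi)=\sqrt{\tfrac{2}{\Phi}}\,\sin\!\left(\frac{n_\phi\pi\phi}{\Phi}\right),\qquad 0\le\phi\le\Phi,$$ be the $n_\phi$-th azimuthal state of the spherical wedge of azimuthal extent $\Phi$. Then $$\langle L_z\rangle:=\int_0^{\Phi}\overline{u_{n_\phi}(\phi)}\,\bigl(\hat L_z u_{n_\phi}\bigr)(\phi)\,d\phi=0,\qquad\text{where }\hat L_z=-i\hbar\,\frac{d}{d\phi}.$$
   Context: The spherical wedge of azimuthal extent $\Phi$ and radius $R>0$ is $\{(r,\theta,\phi):0\le r\le R,\ 0\le\theta\le\pi,\ 0\le\phi\le\Phi\}$ in spherical coordinates, with Dirichlet conditions imposed on its boundary. Its azimuthal states $u_{n_\phi}$ are the $L^2([0,\Phi])$-normalised solutions of $u''+\mu^2u=0$, $u(0)=u(\Phi)=0$, which have $\mu=n_\phi\pi/\Phi$. The operator $\hat L_z$ acts as a differential expression on smooth functions of $\phi$. *)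

(* Defs.v *)
From Stdlib Require Import Reals Lra Lia.
From Coquelicot Require Import Coquelicot.
Open Scope R_scope.

(* Total derivative of a complex-valued function of a real variable, built from
   [is_derive] over the real normed module C as [RInt] is built from [is_RInt].
   ([Derive] covers only real-valued functions, [C_derive] only functions of a
   complex variable.) *)
Definition RC_derive (u : R -> C) (x : R) : C :=
  iota (T := C_R_CompleteNormedModule)
    (fun l => is_derive (V := C_R_NormedModule) u x l).

Lemma is_derive_RC_pair (f g : R -> R) (x a b : R) :
  is_derive f x a -> is_derive g x b ->
  is_derive (V := C_R_NormedModule) (fun t => (f t, g t) : C) x (a, b).
Proof.
  intros Hf Hg.
  exact (filterdiff_comp_2 (T := R_NormedModule) (U := R_NormedModule)
    (V := R_NormedModule) (W := C_R_NormedModule)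
    f g (fun s t => (s, t) : C) _ _ (fun s t => (s, t) : C) Hf Hg
    (filterdiff_ext_lin _ _ _
      (filterdiff_ext _ _ _ (fun z => surjective_pairing z) (filterdiff_id _))
      (fun z => surjective_pairing z))).
Qed.

Lemma RC_derive_unique (u : R -> C) (x : R) (l : C) :
  is_derive (V := C_R_NormedModule) u x l -> RC_derive u x = l.
Proof.
  assert (Hfst : forall m, is_derive (V := C_R_NormedModule) u x m ->
    Derive (fun t => fst (u t)) x = fst m).
  { intros m Hm; apply is_derive_unique.
    exact (filterdiff_comp' (V := C_R_NormedModule) (W := R_NormedModule)
      u (fun z : C => fst z) x _ (fun z : C => fst z) Hm
      (filterdiff_linear _ is_linear_fst)). }
  assert (Hsnd : forall m, is_derive (V := C_R_NormedModule) u x m ->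
    Derive (fun t => snd (u t)) x = snd m).
  { intros m Hm; apply is_derive_unique.
    exact (filterdiff_comp' (V := C_R_NormedModule) (W := R_NormedModule)
      u (fun z : C => snd z) x _ (fun z : C => snd z) Hm
      (filterdiff_linear _ is_linear_snd)). }
  intros Hl.
  apply (iota_unique (V := C_R_CompleteNormedModule)); [|exact Hl].
  intros m Hm.
  apply injective_projections.
  - now rewrite <- (Hfst _ Hm), <- (Hfst _ Hl).
  - now rewrite <- (Hsnd _ Hm), <- (Hsnd _ Hl).
Qed.

Definition Lz (hbar : R) (u : R -> C) (phi : R) : C :=
  (- Ci * RtoC hbar * RC_derive u phi)%C.

Definition Lz_density (hbar : R) (u : R -> C) (phi : R) : C :=
  (Cconj (u phi) * Lz hbar u phi)%C.

Definition mean_Lz (Phi hbar : R) (u : R -> C) : C :=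
  RInt (V := C_R_CompleteNormedModule) (Lz_density hbar u) 0 Phi.

(* A state on [0, Phi] is represented by a smooth function on R, so that its
   two-sided derivatives at 0 and Phi are the one-sided ones of the state. *)
Definition is_azimuthal_state (Phi mu : R) (u : R -> C) : Prop :=
  (exists du : R -> C, forall phi, 0 <= phi <= Phi ->
     is_derive (V := C_R_NormedModule) u phi (du phi) /\
     is_derive (V := C_R_NormedModule) du phi (- RtoC (mu ^ 2) * u phi)%C) /\
  u 0 = RtoC 0 /\ u Phi = RtoC 0 /\
  is_RInt (fun phi => Cmod (u phi) ^ 2) 0 Phi 1.

Definition azimuthal_state (Phi : R) (n : nat) (phi : R) : C :=
  RtoC (sqrt (2 / Phi) * sin (INR n * PI * phi / Phi)).

Lemma azimuthal_state_spec (Phi : R) (n : nat) :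
  0 < Phi -> (1 <= n)%nat ->
  is_azimuthal_state Phi (INR n * PI / Phi) (azimuthal_state Phi n).
Proof.
  intros HPhi Hn.
  assert (Hn0 : 0 < INR n) by (apply lt_0_INR; lia).
  assert (HPI := PI_RGT_0).
  assert (Hsin : forall k : nat, sin (INR k * PI) = 0).
  { intros k; apply sin_eq_0_1; exists (Z.of_nat k); now rewrite <- INR_IZR_INZ. }
  unfold azimuthal_state; repeat split.
  - exists (fun phi =>
      RtoC (sqrt (2 / Phi) * (INR n * PI / Phi) * cos (INR n * PI * phi / Phi))).
    intros phi _; split.
    + apply is_derive_RC_pair; [|apply is_derive_Reals, derivable_pt_lim_const].
      auto_derive; [trivial|unfold Rdiv; ring].
    + replace (- RtoC ((INR n * PI / Phi) ^ 2) *
          RtoC (sqrt (2 / Phi) * sin (INR n * PI * phi / Phi)))%C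
        with ((- (sqrt (2 / Phi) * (INR n * PI / Phi) ^ 2
                   * sin (INR n * PI * phi / Phi)), 0) : C)
        by (unfold RtoC, Cmult, Copp; simpl; f_equal; ring).
      apply is_derive_RC_pair; [|apply is_derive_Reals, derivable_pt_lim_const].
      auto_derive; [trivial|unfold Rdiv; ring].
  - f_equal; replace (INR n * PI * 0 / Phi) with 0 by (field; lra).
    rewrite sin_0; ring.
  - f_equal; replace (INR n * PI * Phi / Phi) with (INR n * PI) by (field; lra).
    rewrite Hsin; ring.
  - set (F := fun phi : R => phi / Phi -
      sin (2 * (INR n * PI * phi / Phi)) / (2 * (INR n * PI))).
    replace 1 with (minus (F Phi) (F 0)).
    + apply is_RInt_ext with (fun phi => 2 / Phi * sin (INR n * PI * phi / Phi) ^ 2).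
      { intros phi _; rewrite Cmod_R, pow2_abs, Rpow_mult_distr, pow2_sqrt; [reflexivity|].
        apply Rlt_le, Rdiv_lt_0_compat; lra. }
      apply (is_RInt_derive (V := R_CompleteNormedModule)).
      * intros phi _; unfold F; auto_derive; [nra|].
        replace (2 * (INR n * PI * phi * / Phi))
          with (2 * (INR n * PI * phi / Phi)) by (unfold Rdiv; ring).
        rewrite cos_2a_sin; field; repeat split; lra.
      * intros phi _; apply (ex_derive_continuous (V := R_NormedModule)).
        auto_derive; trivial.
    + unfold F, minus, plus, opp; simpl.
      replace (2 * (INR n * PI * Phi / Phi)) with (INR (2 * n) * PI)
        by (rewrite mult_INR; simpl; field; lra).
      replace (2 * (INR n * PI * 0 / Phi)) with 0 by (field; lra).
      rewrite Hsin, sin_0; field; repeat split; lra.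
Qed.

(* Main.v *)
Require Import Defs.
From Stdlib Require Import Reals.
From Coquelicot Require Import Coquelicot.
Open Scope R_scope.

(* For a real state [f] the integrand is [-i hbar f f'], the derivative of
    [-i hbar f^2 / 2], so the mean of [L_z] only depends on the values of [f^2]
    at the two ends of the wedge, where [f] vanishes. *)

(** Conjugation fixes real values and the derivative of a real function is real, so the factor
    [- Ci] makes the density purely imaginary. *)
Lemma Lz_density_real (hbar : R) (f : R -> R) (x l : R) :
  is_derive f x l ->
  Lz_density hbar (fun t => RtoC (f t)) x = (0, - hbar * (f x * l)).
Proof.
  intros Hf; unfold Lz_density, Lz.
  rewrite (RC_derive_unique _ x (RtoC l)).
  - unfold Cconj, Cmult, Copp, Ci, RtoC; simpl; f_equal; ring.
  - apply is_derive_RC_pair; [exact Hf|apply is_derive_Reals, derivable_pt_lim_const].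
Qed.

Lemma is_RInt_Lz_density_real (hbar a b : R) (f df : R -> R) :
  (forall x, is_derive f x (df x)) -> (forall x, continuous df x) ->
  is_RInt (V := C_R_NormedModule) (Lz_density hbar (fun t => RtoC (f t))) a b
    (0, - hbar * (f b ^ 2 - f a ^ 2) / 2).
Proof.
  intros Hf Hdf.
  apply is_RInt_ext with (fun x => (0, - hbar * (f x * df x)) : C).
  { intros x _; symmetry; now apply Lz_density_real. }
  (* Integrate the two coordinates separately: the real part is zero, the imaginary part is an exact
     derivative. *)
  apply (is_RInt_fct_extend_pair (U := R_NormedModule) (V := R_NormedModule)); simpl.
  - assert (H := is_RInt_const (V := R_NormedModule) a b 0).
    change (is_RInt (V := R_NormedModule) (fun _ => 0) a b ((b - a) * 0)) in H.
    now rewrite Rmult_0_r in H.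
  (* The products with [1] are squares unfolded by [simpl]; the value becomes the increment of the
     antiderivative [- hbar / 2 * f x ^ 2]. *)
  - replace (- hbar * (f b * (f b * 1) - f a * (f a * 1)) / 2)
      with (minus (- hbar / 2 * f b ^ 2) (- hbar / 2 * f a ^ 2))
      by (unfold minus, plus, opp; simpl; field).
    apply (is_RInt_derive (V := R_CompleteNormedModule)
             (fun x => - hbar / 2 * f x ^ 2)).
    + intros x _.
      (* Shape in which [is_derive_pow] delivers the derivative of the square. *)
      replace (- hbar * (f x * df x))
        with (- hbar / 2 * (INR 2 * df x * f x ^ 1)) by (simpl; field).
      apply (is_derive_scal (fun t => f t ^ 2)), is_derive_pow, Hf.
    + intros x _.
      apply (continuous_mult (K := R_AbsRing) (fun _ => - hbar)).
      * apply continuous_const.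
      * apply (continuous_mult (K := R_AbsRing) f df); [|apply Hdf].
        apply (ex_derive_continuous (V := R_NormedModule)); eexists; apply Hf.
Qed.

(** [RInt] is a total function, so integrability is asserted beside the equation to make the mean a
    genuine integral. *)
Theorem mainTheorem2 (Phi hbar : R) (n : nat)
    (hPhi : 0 < Phi < 2 * PI) (hhbar : 0 < hbar) (hn : (1 <= n)%nat) :
  ex_RInt (V := C_R_NormedModule)
    (Lz_density hbar (azimuthal_state Phi n)) 0 Phi /\
  mean_Lz Phi hbar (azimuthal_state Phi n) = RtoC 0.
Proof.
  assert (H : is_RInt (V := C_R_NormedModule)
                (Lz_density hbar (azimuthal_state Phi n)) 0 Phi (RtoC 0)).
  { set (f := fun x => sqrt (2 / Phi) * sin (INR n * PI * x / Phi)).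
    destruct (azimuthal_state_spec Phi n (proj1 hPhi) hn) as (_ & H0 & H1 & _).
    (* The Dirichlet conditions are equations in [C]; their real parts say that [f] vanishes at both
       ends. *)
    assert (f0 : f 0 = 0) by exact (f_equal fst H0).
    assert (f1 : f Phi = 0) by exact (f_equal fst H1).
    replace (RtoC 0) with ((0, - hbar * (f Phi ^ 2 - f 0 ^ 2) / 2) : C)
      by (rewrite f0, f1; unfold RtoC; f_equal; field).
    apply (is_RInt_Lz_density_real hbar 0 Phi f
      (fun x => sqrt (2 / Phi) * (INR n * PI / Phi) * cos (INR n * PI * x / Phi))).
    - intros x; unfold f; auto_derive; [trivial|unfold Rdiv; ring].
    - intros x; apply (ex_derive_continuous (V := R_NormedModule)).
      auto_derive; trivial. }
  split; [now exists (RtoC 0)|].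
  exact (is_RInt_unique (V := C_R_CompleteNormedModule) _ _ _ _ H).
Qed.
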